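(* Let $K$ be a field, let $A=K[x_1,\ldots,x_m]$, let $I\subseteq A$ be a monomial ideal, and let $f$ be the least common multiple of the generating monomials of $I$. Then $I^{(n)}$ is generated in degrees $\leq \deg(f)\,n$ for all $n>0$.
   Context: The generating monomials of a monomial ideal are the elements of its minimal set of monomial generators. For an ideal $I$ of $A$, the $n$-th symbolic power is $I^{(n)}:=\bigcap_{\mathfrak p\in \mathrm{Ass}(I)}(I^nA_{\mathfrak p}\cap A)$, where $\mathrm{Ass}(I)$ denotes the set of associated primes of $A/I$. The ring $A$ has the standard grading, and an ideal is generated in degrees $\leq d$ if it has a generating set consisting of polynomials of degree $\leq d$; for a homogeneous ideal these may be taken homogeneous. *)

(* Defs.v *)
From HB Require Import structures.
From mathcomp Require Import all_boot all_order all_algebra fraction.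
From mathcomp Require Import mpoly.
From Stdlib Require Import Classical.

Set Implicit Arguments.
Unset Strict Implicit.
Unset Printing Implicit Defensive.

Import GRing.Theory.
Local Open Scope ring_scope.

(* Subsets of a ring are Prop-valued predicates: ideals need not be decidable. *)

Section Ideals.
Variable R : comNzRingType.
Implicit Types (C S I J P : R -> Prop).

Definition is_ideal I : Prop :=
  [/\ I 0, forall x y, I x -> I y -> I (x + y) & forall a x, I x -> I (a * x)].

Definition is_prime_ideal P : Prop :=
  [/\ is_ideal P, ~ P 1 & forall x y, P (x * y) -> P x \/ P y].

(* finite sums of products c * s with c in C and s in S *)
Definition combinations C S : R -> Prop := fun x =>
  exists2 r : seq (R * R),
    (forall t, t \in r -> C t.1 /\ S t.2) & x = \sum_(t <- r) t.1 * t.2.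

Definition ideal_gen S : R -> Prop := combinations (fun=> True) S.

Definition ideal_mul I J : R -> Prop := combinations I J.

Fixpoint ideal_exp I (n : nat) : R -> Prop :=
  if n is n'.+1 then ideal_mul I (ideal_exp I n') else fun=> True.

(* P is prime and is the annihilator of the class of some a in R / I. *)
Definition associated_prime I P : Prop :=
  is_prime_ideal P /\ exists a, forall r, P r <-> I (r * a).

End Ideals.

Section SymbolicPower.
Variable A : idomainType.
Implicit Types (I J P : A -> Prop).

(* A_P, as a subring of the fraction field of the domain A *)
Definition localization P : {fraction A} -> Prop := fun x =>
  exists a s, ~ P s /\ x = tofrac a / tofrac s.

(* J A_P, the ideal of A_P generated by the image of J *)
Definition extension P J : {fraction A} -> Prop :=
  combinations (localization P) (fun y => exists2 b, J b & y = tofrac b).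

(* For I = A there is no associated prime, and the empty intersection is A. *)
Definition symbolic_power I (n : nat) : A -> Prop := fun a =>
  forall P, associated_prime I P -> extension P (ideal_exp I n) (tofrac a).

End SymbolicPower.

Section MonomialIdeals.
Variables (m : nat) (K : fieldType).
Implicit Types (I J : {mpoly K[m]} -> Prop) (S : 'X_{1..m} -> Prop).

Definition monomial_span S : {mpoly K[m]} -> Prop :=
  ideal_gen (fun p => exists2 u, S u & p = 'X_[u]).

Definition monomial_ideal I : Prop :=
  exists S, forall p, I p <-> monomial_span S p.

Definition monomial_generators I (G : seq 'X_{1..m}) : Prop :=
  forall p, I p <-> monomial_span (fun u => u \in G) p.

(* G is listed as a sequence: minimal monomial generating sets are finite, by
   Dickson's lemma. Inclusion-minimality is taken on the underlying sets. *)
Definition minimal_monomial_generators I (G : seq 'X_{1..m}) : Prop :=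
  monomial_generators I G /\
  forall H : seq 'X_{1..m},
    {subset H <= G} -> monomial_generators I H -> {subset G <= H}.

Definition monomial_lcm (G : seq 'X_{1..m}) : 'X_{1..m} :=
  \big[@mlcm m/0%MM]_(u <- G) u.

(* msize p is the total degree of p plus one, and msize 0 = 0. *)
Definition generated_in_degrees_le J (d : nat) : Prop :=
  exists2 S : {mpoly K[m]} -> Prop,
    forall g, S g -> (msize g <= d.+1)%N
  & forall p, J p <-> ideal_gen S p.

Lemma monomial_span_sub S (T : 'X_{1..m} -> Prop) :
  (forall u, S u -> exists2 v, T v & (v <= u)%MM) ->
  forall p, monomial_span S p -> monomial_span T p.
Proof.
move=> ST p [r rS ->]; elim: r rS => [|t r IHr] rS.
  by exists [::] => //; rewrite !big_nil.
have [|s sT sE] := IHr; first by move=> x xr; apply: rS; rewrite inE xr orbT.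
have [_ [u Su tE]] := rS t (mem_head _ _).
have [v Tv vu] := ST u Su.
exists ((t.1 * 'X_[u - v], 'X_[v]) :: s).
  move=> x; rewrite inE => /orP[/eqP->|/sT//]; split=> //=.
  by exists v.
by rewrite !big_cons sE /= tE -mulrA -mpolyXD submK.
Qed.

Lemma monomial_span_X S u :
  monomial_span S 'X_[u] <-> exists2 v, S v & (v <= u)%MM.
Proof.
split=> [[r rS /(congr1 (mcoeff u))]|[v Sv vu]]; last first.
  apply: (@monomial_span_sub (eq^~ u)); first by move=> _ ->; exists v.
  exists [:: (1, 'X_[u])]; last by rewrite big_seq1 mul1r.
  by move=> t; rewrite inE => /eqP->; split=> //; exists u.
rewrite mcoeffX eqxx => sE; apply: NNPP => noS.
have /eqP := sE; rewrite raddf_sum /= big_seq big1 ?oner_eq0 // => t tr.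
have [_ [v Sv ->]] := rS t tr.
apply: memN_msupp_eq0; apply/negP.
rewrite (perm_mem (msuppMX _ _)) => /mapP[w _ uE].
by apply: noS; exists v => //; rewrite uE lem_addr.
Qed.

Local Open Scope nat_scope.

Lemma dickson S : exists2 B : seq 'X_{1..m},
  forall b, b \in B -> S b & forall u, S u -> exists2 b, b \in B & (b <= u)%MM.
Proof.
suff H k : k <= m -> forall T : 'X_{1..m} -> Prop,
  exists2 B : seq 'X_{1..m}, forall b, b \in B -> T b
    & forall u, T u -> exists2 b, b \in B & forall i : 'I_m, i < k -> b i <= u i.
  have [B BS SB] := H m (leqnn m) S; exists B => // u /SB[b bB bu].
  by exists b => //; apply/mnm_lepP => i; apply: bu.
elim: k => [_ T|k IHk ltkm T].
  have [[u Tu]|noT] := classic (exists u, T u).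
    by exists [:: u] => [b|v _]; [rewrite inE => /eqP-> | exists u; rewrite ?mem_head].
  by exists [::] => // u Tu; case: noT; exists u.
have [B BT TB] := IHk (ltnW ltkm) T.
pose ik := Ordinal ltkm.
have [C CT TC] : exists2 C : seq 'X_{1..m}, forall b, b \in C -> T b
    & forall u, T u -> u ik < \max_(b <- B) b ik ->
      exists2 b, b \in C & forall i : 'I_m, i < k.+1 -> b i <= u i.
  elim: (\max_(b <- B) b ik) => [|N [C CT TC]]; first by exists [::].
  have [D DT TD] := IHk (ltnW ltkm) (fun u => T u /\ u ik = N).
  exists (C ++ D) => [b|u Tu].
    by rewrite mem_cat => /orP[/CT|/DT[]].
  rewrite ltnS leq_eqVlt => /orP[/eqP uN|/(TC u Tu)[b bC bu]]; last first.
    by exists b; rewrite ?mem_cat ?bC.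
  have [//|b bD bu] := TD u; exists b; rewrite ?mem_cat ?bD ?orbT // => i.
  rewrite ltnS leq_eqVlt => /orP[/eqP ik_|/bu//].
  have -> : i = ik by apply: val_inj.
  by rewrite uN; have [_ ->] := DT b bD.
exists (B ++ C) => [b|u Tu]; first by rewrite mem_cat => /orP[/BT|/CT].
have [/(TC u Tu)[b bC bu]|leNu] := ltnP (u ik) (\max_(b <- B) b ik).
  by exists b; rewrite ?mem_cat ?bC ?orbT.
have [b bB bu] := TB u Tu; exists b; rewrite ?mem_cat ?bB // => i.
rewrite ltnS leq_eqVlt => /orP[/eqP ik_|/bu//].
have -> : i = ik by apply: val_inj.
by apply: leq_trans leNu; rewrite (big_rem b) //= leq_maxl.
Qed.

Lemma minimal_monomial_generators_exist I :
  monomial_ideal I -> exists G, minimal_monomial_generators I G.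
Proof.
move=> [S IS].
pose M u := I 'X_[u] /\ forall v, I 'X_[v] -> (v <= u)%MM -> v = u.
have IM u : I 'X_[u] -> exists2 v, M v & (v <= u)%MM.
  have [n] := ubnP (mdeg u); elim: n u => // n IHn u; rewrite ltnS => un Iu.
  have [Mu|nMu] := classic (M u); first by exists u; rewrite ?lepm_refl.
  have [v [Iv vu vNu]] : exists v, [/\ I 'X_[v], (v <= u)%MM & v <> u].
    apply: NNPP => nov; apply: nMu; split=> // v Iv vu.
    by apply: NNPP => vNu; apply: nov; exists v.
  have [|w Mw wv] := IHn v _ Iv; last by exists w => //; apply: lepm_trans vu.
  apply: leq_trans un; rewrite -(submK vu) mdegD -[X in X < _]add0n ltn_add2r.
  rewrite lt0n mdeg_eq0; apply/eqP => uv0.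
  by apply: vNu; rewrite -[RHS](submK vu) uv0 add0m.
have [G GM MG] := dickson M.
have GE : monomial_generators I G.
  move=> p; rewrite IS; split; apply: monomial_span_sub => u.
    move=> Su; have [|v Mv vu] := IM u.
      by apply/IS/monomial_span_X; exists u; rewrite ?lepm_refl.
    by have [b bG bv] := MG v Mv; exists b => //; apply: lepm_trans vu.
  by move=> /GM[/IS/monomial_span_X].
exists G; split=> // H HG HE u uG; have [Iu uM] := GM u uG.
have /HE/monomial_span_X[v vH vu] := Iu.
by rewrite -(uM v) //; apply: (GM v (HG v vH)).1.
Qed.

End MonomialIdeals.

(* Main.v *)
(**
Inverting the monomials outside a prime P sets the variables outside P to 1:
I^n A_P ∩ A is generated by the restrictions, to the variables lying in P, of
the n-fold products of generators of I.  Indeed such an ideal is generated by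
monomials in the variables of P, whereas an element outside P has a term free
of these variables, hence is a nonzerodivisor modulo it.  Every n-fold product
of generators divides f^n, so a monomial X^u lies in I^n A_P ∩ A if and only
if gcd(X^u, f^n) does.  This persists in the intersection over P, which is
therefore generated by monomials dividing f^n.
*)
Require Import Defs.
From mathcomp Require Import all_boot all_order all_algebra fraction.
From mathcomp Require Import mpoly.
From Stdlib Require Import Classical.

Set Implicit Arguments.
Unset Strict Implicit.
Unset Printing Implicit Defensive.

Import GRing.Theory.
Local Open Scope ring_scope.

(** * Finite combinations and extension of ideals to a localization *)

Section Combinations.
Variable R : comNzRingType.
Implicit Types C S J P : R -> Prop.

Lemma combinations_ind C S J :
    J 0 -> (forall x y, J x -> J y -> J (x + y)) ->
    (forall c s, C c -> S s -> J (c * s)) ->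
  forall x, combinations C S x -> J x.
Proof.
move=> J0 JD JM x [r rCS ->].
by rewrite big_seq; apply: (big_ind J) => // t /rCS[Ct St]; apply: JM.
Qed.

Lemma combinations0 C S : combinations C S 0.
Proof. by exists [::]; rewrite ?big_nil. Qed.

Lemma combinationsD C S x y :
  combinations C S x -> combinations C S y -> combinations C S (x + y).
Proof.
move=> [r rCS ->] [s sCS ->]; exists (r ++ s); last by rewrite big_cat.
by move=> t; rewrite mem_cat => /orP[/rCS|/sCS].
Qed.

Lemma combinationsM C S c s : C c -> S s -> combinations C S (c * s).
Proof.
move=> Cc Ss; exists [:: (c, s)]; last by rewrite big_seq1.
by move=> t; rewrite inE => /eqP->.
Qed.

Lemma ideal_gen_ideal S : is_ideal (ideal_gen S).
Proof.
split=> [|x y|a x]; [exact: combinations0 | exact: combinationsD|].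
apply: (combinations_ind (J := fun x => ideal_gen S (a * x)))
  => [|y z Sy Sz|c s _ Ss].
- by rewrite mulr0; apply: combinations0.
- by rewrite mulrDr; apply: combinationsD.
by rewrite mulrA; apply: combinationsM.
Qed.

Lemma prime_notM P x y : is_prime_ideal P -> ~ P x -> ~ P y -> ~ P (x * y).
Proof. by move=> [_ _ PM] nx ny /PM[]. Qed.

End Combinations.

(** The fractions [b / s] with [b] in [J] and [s] outside [P] are closed under sums and under
    multiplication by [localization P], because primality keeps products of denominators outside
    [P]. *)
Lemma extensionP (A : idomainType) (P J : A -> Prop) a :
    is_prime_ideal P -> is_ideal J ->
  extension P J (tofrac a) <-> exists2 s, ~ P s & J (a * s).
Proof.
move=> Pprime [J0 JD JM]; have [[P0 _ _] nP1 _] := Pprime.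
have tofracN0 s : ~ P s -> tofrac s != 0.
  by move=> nPs; rewrite tofrac_eq0; apply/eqP => s0; apply: nPs; rewrite s0.
split=> [|[s nPs Jas]]; last first.
  have -> : tofrac a = (tofrac 1 / tofrac s) * tofrac (a * s).
    by rewrite tofrac1 div1r mulrC tofracM mulfK ?tofracN0.
  by apply: combinationsM; [exists 1, s | exists (a * s)].
move=> /(@combinations_ind _ _ _ (fun x =>
  exists s b, [/\ ~ P s, J b & x = tofrac b / tofrac s])) [].
- by exists 1, 0; rewrite tofrac0 mul0r.
- move=> _ _ [s [b [nPs Jb ->]]] [t [c [nPt Jc ->]]].
  exists (s * t), (t * b + s * c); split; first exact: prime_notM.
    by apply: JD; apply: JM.
  rewrite addf_div ?tofracN0 // tofracD !tofracM.
  by congr ((_ + _) / _); rewrite mulrC.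
- move=> _ _ [c [s [nPs ->]]] [b Jb ->]; exists s, (c * b); split=> //.
    exact: JM.
  by rewrite tofracM mulrAC.
move=> s [b [nPs Jb ab]]; exists s => //.
suff -> : a * s = b by [].
by apply/eqP; rewrite -tofrac_eq tofracM ab divfK ?tofracN0.
Qed.

(** * Monomial ideals, supports and powers *)

Section Monomials.
Variables (m : nat) (K : fieldType).
Implicit Types (I P : {mpoly K[m]} -> Prop) (S T : 'X_{1..m} -> Prop).
Implicit Types (F : pred 'I_m) (p a s : {mpoly K[m]}) (u v : 'X_{1..m}).

Lemma monomial_span_ideal S : is_ideal (@monomial_span m K S).
Proof. exact: ideal_gen_ideal. Qed.

(** Multiplication by ['X_[v]] shifts supports by [v], and sums create no new exponents; conversely
    [p] is the sum of its terms. *)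
Lemma monomial_spanP S p :
  monomial_span S p <->
  forall u, u \in msupp p -> exists2 v, S v & (v <= u)%MM.
Proof.
split.
  move: p; apply: combinations_ind => [u|x y Jx Jy u|c _ _ [v Sv ->] u].
  - by rewrite msupp0.
  - by move/msuppD_le; rewrite mem_cat => /orP[/Jx|/Jy].
  rewrite (perm_mem (msuppMX _ _)) => /mapP[w _ ->].
  by exists v => //; rewrite lem_addr.
move=> pS; have [S0 SD SM] := monomial_span_ideal S.
rewrite (mpolyE p) big_seq; apply: (big_ind (monomial_span S)) => // u /pS vS.
by rewrite -mul_mpolyC; apply/SM/monomial_span_X.
Qed.

Fixpoint exponent_sums S n : 'X_{1..m} -> Prop :=
  if n is n'.+1
  then fun u => exists v w, [/\ S v, exponent_sums S n' w & u = (v + w)%MM]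
  else fun u => u = 0%MM.

(** Each term of a product is divisible by a product of generators of the two factors; for [n = 0]
    the exponent 0 spans the whole ring. *)
Lemma ideal_exp_monomial I S n p :
    (forall q, I q <-> monomial_span S q) ->
  ideal_exp I n p <-> monomial_span (exponent_sums S n) p.
Proof.
move=> IS; elim: n p => [|n IHn] p /=.
  split=> // _; apply/monomial_spanP => u _; exists 0%MM => //.
  by apply/mnm_lepP => i; rewrite mnm0E.
have [_ _ SM] := monomial_span_ideal S.
have [S0 SD _] := monomial_span_ideal (exponent_sums S n.+1).
split; move: p; apply: combinations_ind => //; last 2 first.
- exact: combinationsD.
- move=> c _ _ [_ [v [w [Sv Sw ->]]] ->]; rewrite mpolyXD mulrA.
  apply: combinationsM.
    by apply/IS/SM/monomial_span_X; exists v; rewrite ?lepm_refl.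
  by apply/IHn/monomial_span_X; exists w; rewrite ?lepm_refl.
- move=> c s /IS/monomial_spanP cS /IHn/monomial_spanP sS.
  apply/monomial_spanP => u /msuppM_le/allpairsP[[v w] /= [/cS[v' Sv' le_v]]].
  move=> /sS[w' Sw' le_w] ->; exists (v' + w')%MM; first by exists v', w'.
  apply/mnm_lepP => i; rewrite !mnmDE.
  by rewrite leq_add // (mnm_lepP le_v, mnm_lepP le_w).
exact: combinations0.
Qed.

Lemma exponent_sums_le S f n u :
    (forall v, S v -> (v <= f)%MM) -> exponent_sums S n u -> (u <= f *+ n)%MM.
Proof.
move=> Sf; elim: n u => [_ ->|n IHn _ [v [w [/Sf vf /IHn wf ->]]]].
  by apply/mnm_lepP => i; rewrite mnm0E.
apply/mnm_lepP => i; rewrite mulmS !mnmDE.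
by rewrite leq_add // (mnm_lepP vf, mnm_lepP wf).
Qed.

(** * Restriction of exponents to [F], that is, setting the variables outside [F] to 1 *)

Definition mrestr F u : 'X_{1..m} := [multinom if F i then u i else 0%N | i < m].

Lemma mrestrD F u v : mrestr F (u + v) = (mrestr F u + mrestr F v)%MM.
Proof. by apply/mnmP => i; rewrite !mnmE; case: (F i). Qed.

Lemma mrestr_le F u v : (mrestr F u <= v)%MM = (mrestr F u <= mrestr F v)%MM.
Proof.
by apply/mnm_lepP/mnm_lepP => uv i; move: (uv i); rewrite !mnmE; case: (F i).
Qed.

(** Serves to cut out the components of a polynomial in the grading by restricted exponent. *)
Definition mfilter (b : pred 'X_{1..m}) p : {mpoly K[m]} :=
  \sum_(u <- msupp p | b u) p@_u *: 'X_[u].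

Lemma mcoeff_mfilter b p u : (mfilter b p)@_u = if b u then p@_u else 0.
Proof.
rewrite /mfilter big_mkcond raddf_sum /=.
have [up|/memN_msupp_eq0 pu0] := boolP (u \in msupp p); last first.
  rewrite pu0 if_same big1 // => v _; case: (b v); last by rewrite mcoeff0.
  rewrite mcoeffZ mcoeffX; case: eqP => [->|]; last by rewrite mulr0.
  by rewrite pu0 mul0r.
rewrite (bigD1_seq u) //= big1 ?addr0 => [|v vu].
  by case: (b u); rewrite ?mcoeff0 // mcoeffZ mcoeffX eqxx mulr1.
by case: (b v); rewrite ?mcoeff0 // mcoeffZ mcoeffX (negPf vu) mulr0.
Qed.

Lemma msupp_mfilter b p u : (u \in msupp (mfilter b p)) = b u && (u \in msupp p).
Proof. by rewrite !mcoeff_msupp mcoeff_mfilter; case: (b u); rewrite ?eqxx. Qed.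

Lemma msupp_subr_mfilter b p u :
  (u \in msupp (p - mfilter b p)) = ~~ b u && (u \in msupp p).
Proof.
rewrite !mcoeff_msupp mcoeffB mcoeff_mfilter.
by case: (b u); rewrite ?subrr ?eqxx ?subr0.
Qed.

Lemma mfilter_neq0 (b : pred _) p u : b u -> u \in msupp p -> mfilter b p != 0.
Proof.
move=> bu pu; rewrite -msupp_eq0; apply/eqP => p0.
by have := msupp_mfilter b p u; rewrite p0 bu pu.
Qed.

(* Grade by the restricted exponent.  For a counterexample u of least restricted
   degree, the part of a * s in the degree of u is the product of the part of a
   in that degree and the part of s in degree 0, up to exponents from T. *)
Lemma mrestr_nonzerodivisor F T a s v0 :
    v0 \in msupp s -> mrestr F v0 = 0%MM ->
    (forall u, u \in msupp (a * s) -> exists2 e, T e & (mrestr F e <= u)%MM) ->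
  forall u, u \in msupp a -> exists2 e, T e & (mrestr F e <= u)%MM.
Proof.
move=> sv0 v00 asT u; have [k] := ubnP (mdeg (mrestr F u)).
elim: k u => // k IHk u0; rewrite ltnS => u0k au0; apply: NNPP => nTu0.
(* If [v] involved a variable of [F], then [u] would have smaller restricted degree, so by induction
   some restricted [e] from [T] would lie below [u], hence below [u0]. *)
have split_u0 u v : u \in msupp a -> mrestr F (u + v) = mrestr F u0 ->
    mrestr F u = mrestr F u0 /\ mrestr F v = 0%MM.
  rewrite mrestrD => au uv; have [v_eq0|v_gt0] := posnP (mdeg (mrestr F v)).
    move/eqP: v_eq0; rewrite mdeg_eq0 => /eqP v_eq0.
    by move: uv; rewrite v_eq0 addm0.
  have [|//|e Te eu] := IHk u.
    by apply: leq_trans u0k; rewrite -uv mdegD -[X in (X < _)%N]addn0 ltn_add2l.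
  case: nTu0; exists e => //; rewrite mrestr_le -uv.
  by move: eu; rewrite mrestr_le => /lepm_trans; apply; rewrite lem_addr.
pose c := mfilter (fun u => mrestr F u == mrestr F u0) a.
pose d := mfilter (fun v => mrestr F v == 0%MM) s.
have c0 : c != 0 by apply: mfilter_neq0 au0.
have d0 : d != 0 by apply: mfilter_neq0 sv0; apply/eqP.
have [w cdw] : exists w, w \in msupp (c * d).
  have: c * d != 0 by rewrite mulf_neq0.
  rewrite -msupp_eq0; case: (msupp _) => // w r _; exists w; exact: mem_head.
have wu0 : mrestr F w = mrestr F u0.
  have /allpairsP[[u v] /= [+ + ->]] := msuppM_le cdw.
  rewrite !msupp_mfilter => /andP[/eqP uu0 _] /andP[/eqP vv0 _].
  by rewrite mrestrD uu0 vv0 addm0.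
have [|e Te ew] := asT w; last first.
  by apply: nTu0; exists e => //; rewrite mrestr_le -wu0 -mrestr_le.
(* By [split_u0] neither correction term contains [w], so the coefficient of [a * s] at [w] is that
   of [c * d]. *)
have -> : a * s = c * d + ((a - c) * s + c * (s - d)).
  by rewrite mulrBl mulrBr subrKA addrC subrK.
rewrite mcoeff_msupp !mcoeffD (_ : ((a - c) * s)@_w = 0); last first.
  apply: memN_msupp_eq0; apply/negP => /msuppM_le/allpairsP[[u v] /= [+ _ wE]].
  rewrite msupp_subr_mfilter => /andP[/eqP uu0 au]; apply: uu0.
  by have [|] := split_u0 u v au; rewrite -?wE.
rewrite (_ : (c * (s - d))@_w = 0) ?addr0 -?mcoeff_msupp //.
apply: memN_msupp_eq0; apply/negP => /msuppM_le/allpairsP[[u v] /= [+ + wE]].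
rewrite msupp_mfilter msupp_subr_mfilter => /andP[_ au] /andP[/eqP vv0 _].
by apply: vv0; have [|] := split_u0 u v au; rewrite -?wE.
Qed.

(** * Primes, the variables they contain, and symbolic powers *)

Lemma prime_ideal_variables P :
  exists F : 'I_m -> bool, forall i, F i <-> P 'X_i.
Proof.
(* Membership in [P] is only a proposition; finite choice over ['I_m] turns it into booleans on
   which [mrestr] can branch. *)
apply: (@fin_all_exists _ (fun=> bool) (fun i b => b <-> P 'X_i)) => i.
by have [Pi|nPi] := classic (P 'X_i); [exists true | exists false].
Qed.

(** If every term of [s] involved a variable from [F], each term, and hence [s], would lie in
    [P]. *)
Lemma prime_ideal_term P F s :
    is_ideal P -> (forall i, F i -> P 'X_i) -> ~ P s ->
  exists2 v, v \in msupp s & mrestr F v = 0%MM.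
Proof.
move=> [P0 PD PM] FP nPs; apply: NNPP => no_v; apply: nPs.
rewrite (mpolyE s) big_seq; apply: (big_ind P) => // v sv.
rewrite -mul_mpolyC; apply: (PM).
have [i Fi vi] : exists2 i, F i & v i != 0%N.
  apply: NNPP => no_i; apply: no_v; exists v => //.
  apply/mnmP => i; rewrite mnmE mnm0E; case: ifP => // Fi.
  by apply/eqP/negP => /negP vi; apply: no_i; exists i.
by rewrite -(@submK _ U_(i) v) ?lep1mP // mpolyXD; apply/PM/FP.
Qed.

(** The monomial is a product of variables outside [P], and the complement of a prime is
    multiplicative. *)
Lemma prime_idealX P F u :
    is_prime_ideal P -> (forall i, P 'X_i -> F i) ->
    (forall i, F i -> u i = 0%N) ->
  ~ P 'X_[u].
Proof.
move=> Pprime PF uF; have [_ nP1 _] := Pprime.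
rewrite mpolyXE_id; apply: (big_ind (fun x => ~ P x)) => // [x y|i _].
  exact: prime_notM.
case: (boolP (F i)) => [/uF->//|/negP nFi].
elim: (u i) => [|k IHk]; first by rewrite expr0.
by rewrite exprS; apply: prime_notM => // /PF.
Qed.

(** A denominator outside [P] has a term free of the variables in [P], so [mrestr_nonzerodivisor]
    cancels it; conversely a monomial in the other variables serves as denominator. *)
Lemma extension_ideal_exp I S f n P F a :
    (forall q, I q <-> monomial_span S q) -> (forall v, S v -> (v <= f)%MM) ->
    is_prime_ideal P -> (forall i, F i <-> P 'X_i) ->
  extension P (ideal_exp I n) (tofrac a) <->
  forall u, u \in msupp a ->
    exists2 e, exponent_sums S n e & (mrestr F e <= u)%MM.
Proof.
move=> IS Sf Pprime FP; have [Pideal _ _] := Pprime.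
have InS q := ideal_exp_monomial n q IS.
have In_ideal : is_ideal (ideal_exp I n).
  have [J0 JD JM] := monomial_span_ideal (exponent_sums S n).
  split=> [|x y /InS Ix /InS Iy|b x /InS Ix]; apply/InS => //.
    exact: JD.
  exact: JM.
rewrite extensionP //; split.
  move=> [s nPs /InS/monomial_spanP asS].
  have [v sv v0] := prime_ideal_term Pideal (fun i => (FP i).1) nPs.
  apply: (mrestr_nonzerodivisor sv v0) => u /asS[e Se eu]; exists e => //.
  apply: lepm_trans eu; apply/mnm_lepP => i; rewrite mnmE.
  by case: (F i).
(* This part of [f^n] restores, for every [e] at once, the exponents dropped by [mrestr F], since
   [e] is at most [f *+ n]. *)
move=> aS; exists 'X_[mrestr (predC F) (f *+ n)].
  apply: (prime_idealX Pprime (fun i => (FP i).2)) => i Fi.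
  by rewrite mnmE /= Fi.
apply/InS/monomial_spanP => u; rewrite (perm_mem (msuppMX _ _)).
move=> /mapP[w /aS[e Se ew] ->]; exists e => //.
have ef := exponent_sums_le Sf Se.
apply/mnm_lepP => i; move: (mnm_lepP ew i) (mnm_lepP ef i).
rewrite !mnmDE !mnmE /=; case: (F i) => //= _ ei.
by apply: leq_trans (leq_addr _ _).
Qed.

Lemma symbolic_powerP I S f n :
    (forall q, I q <-> monomial_span S q) -> (forall v, S v -> (v <= f)%MM) ->
  exists U : 'X_{1..m} -> Prop,
    [/\ forall p, symbolic_power I n p <-> forall u, u \in msupp p -> U u,
        forall u v, U u -> (u <= v)%MM -> U v
      & forall u, U u -> exists v, [/\ U v, (v <= u)%MM & (v <= f *+ n)%MM]].
Proof.
(* [U] collects the exponents of the monomials in the symbolic power; quantifying over [F], which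
   [P] determines, avoids choosing it for each [P]. *)
move=> IS Sf; exists (fun u => forall P F, associated_prime I P ->
  (forall i, F i <-> P 'X_i) ->
  exists2 e, exponent_sums S n e & (mrestr F e <= u)%MM).
split=> [p|u v Uu uv P F PI FP|u Uu]; last 1 first.
(* The exponent of the gcd of ['X_[u]] and [f^n] does not depend on [P], so one witness serves all
   associated primes. *)
- exists [multinom minn (u i) ((f *+ n)%MM i) | i < m]; split; last 2 first.
  + by apply/mnm_lepP => i; rewrite mnmE geq_minl.
  + by apply/mnm_lepP => i; rewrite mnmE geq_minr.
  move=> P F PI FP; have [e Se eu] := Uu P F PI FP; exists e => //.
  apply/mnm_lepP => i; rewrite [leqRHS]mnmE leq_min (mnm_lepP eu) mnmE.
  by case: (F i); rewrite ?(mnm_lepP (exponent_sums_le Sf Se)).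
- split=> [Ip u pu P F PI FP|pU P PI].
    have [Pprime _] := PI.
    by apply: (extension_ideal_exp n p IS Sf Pprime FP).1 pu; apply: Ip.
  have [F FP] := prime_ideal_variables P; have [Pprime _] := PI.
  apply: (extension_ideal_exp n p IS Sf Pprime FP).2 => u /pU Uu.
  exact: Uu PI FP.
- by have [e Se eu] := Uu P F PI FP; exists e => //; apply: lepm_trans uv.
Qed.

End Monomials.

(** * The degree bound *)

Lemma monomial_lcm_dvd m (G : seq 'X_{1..m}) u :
  u \in G -> (u <= monomial_lcm G)%MM.
Proof.
rewrite /monomial_lcm; elim: G => // v G IHG; rewrite inE big_cons.
case/orP=> [/eqP->|/IHG uG]; first exact: lem_mlcml.
exact: lepm_trans uG (lem_mlcmr _ _).
Qed.

Lemma leq_mdeg m (u v : 'X_{1..m}) : (u <= v)%MM -> (mdeg u <= mdeg v)%N.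
Proof. by move=> uv; rewrite -(submK uv) mdegD leq_addl. Qed.

Theorem corollary1p4 (K : fieldType) (m : nat) (I : {mpoly K[m]} -> Prop)
    (G : seq 'X_{1..m}) (f : 'X_{1..m}) :
  monomial_ideal I ->
  minimal_monomial_generators I G ->
  f = monomial_lcm G ->
  forall n : nat, (0 < n)%N ->
    generated_in_degrees_le (symbolic_power I n) (mdeg f * n).
Proof.
move=> _ [IG _] -> n _.
have [U [IU Uup Umin]] := symbolic_powerP n IG (@monomial_lcm_dvd m G).
(* The generators are the monomials of the symbolic power dividing [f^n], whose degrees are at most
   that of [f^n]. *)
exists (fun g => exists2 u, U u /\ (u <= monomial_lcm G *+ n)%MM & g = 'X_[u]).
  by move=> _ [u [_ uf] ->]; rewrite msizeX ltnS -mdegMn leq_mdeg.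
pose V u := U u /\ (u <= monomial_lcm G *+ n)%MM.
suff UV u : U u <-> exists2 v, V v & (v <= u)%MM.
  move=> p; split=> [/IU pU|/(monomial_spanP V) pV].
    by apply/(monomial_spanP V) => u /pU/UV.
  by apply/IU => u /pV/UV.
split=> [/Umin[v [Uv vu vf]]|]; first by exists v.
by move=> [v [Uv _]]; apply: Uup.
Qed.
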